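(* Let $A$ be a finite-dimensional bialgebra over a field $\mathbf{k}$ with basis $\{c_i\}_{i\in I}$ and structure constants $$c_i\cdot c_j=\sum_{k\in I}F_{ij}^k c_k,\quad u(1)=\sum_{i\in I}\lambda_i c_i,\quad \Delta(c_k)=\sum_{i,j\in I}G_{ij}^k\, c_i\otimes c_j .$$ Assume $F_{ij}^k=G_{ij}^k$ for all $i,j,k\in I$. Let $(A^\imath,\diamond)$ be the vector space with the same basis $\{c_i\}_{i\in I}$ as $A$, equipped with the bilinear multiplication $c_i\diamond c_j=\sum_{k\in I}{}^\imath F_{ij}^k c_k$, where $${}^\imath F_{ij}^k=\sum_{i',j',k'\in I}F_{i'k'}^j\,F_{k'j'}^i\,F_{j'i'}^k\qquad\text{for any } i,j,k\in I.$$ Then $(A^\imath,\diamond)$ is an associative algebra with the unit $u(1)=\sum_i\lambda_i c_i$.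
   Context: Here $u:\mathbf{k}\to A$ is the unit map of $A$ and $\Delta$ its comultiplication. *)

(* Defs.v *)
From HB Require Import structures.
From mathcomp Require Import all_boot all_order all_algebra all_field.

Set Implicit Arguments.
Unset Strict Implicit.
Unset Printing Implicit Defensive.

Import GRing.Theory.
Local Open Scope ring_scope.

(* MathComp has no tensor product of abstract vector spaces.  For finite-      *)
(* dimensional U and V, realise it as the matrices indexed by the library's    *)
(* bases of U and V, with u ⊗ v the outer product of coordinate vectors;       *)
(* [tens_liftE] and [tens_lift_uniq] are its universal property.               *)
Definition tens (k : fieldType) (U V : vectType k) : Type :=
  'M[k]_(\dim {:U}, \dim {:V}).

HB.instance Definition _ (k : fieldType) (U V : vectType k) :=
  Vector.copy (tens U V) 'M[k]_(\dim {:U}, \dim {:V}).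

Definition tensor (k : fieldType) (U V : vectType k) (u : U) (v : V) :
    tens U V :=
  \matrix_(i, j) (coord (vbasis {:U}) i u * coord (vbasis {:V}) j v).

Notation "u ⊗ v" := (tensor u v) (at level 40, left associativity) : ring_scope.

Definition bilin (k : fieldType) (U V W : lmodType k) (b : U -> V -> W) : Prop :=
  (forall u, linear (b u)) /\ (forall v, linear (b^~ v)).

(* The linear map sending u ⊗ v to b u v, meaningful for bilinear b. *)
Definition tens_lift (k : fieldType) (U V W : vectType k) (b : U -> V -> W)
    (t : tens U V) : W :=
  \sum_(i < \dim {:U}) \sum_(j < \dim {:V})
    (t : 'M_(_, _)) i j *: b (vbasis {:U})`_i (vbasis {:V})`_j.

Section TensorTheory.
Variables (k : fieldType) (U V W : vectType k).
Implicit Types (b : U -> V -> W) (f : {linear tens U V -> W}).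

Fact tens_lift_is_linear b : linear (tens_lift b).
Proof.
move=> a s t; rewrite /tens_lift scaler_sumr -big_split /=.
apply: eq_bigr => i _; rewrite scaler_sumr -big_split /=.
by apply: eq_bigr => j _; rewrite !mxE scalerDl scalerA.
Qed.

HB.instance Definition _ b :=
  GRing.isLinear.Build k (tens U V) W _ (tens_lift b) (tens_lift_is_linear b).

Lemma tensor_bilin : bilin (@tensor k U V).
Proof.
split=> [u|v] a x y; apply/matrixP=> i j; rewrite !mxE linearP /=.
  by rewrite mulrDr mulrCA.
by rewrite mulrDl mulrA.
Qed.

Lemma tens_liftE b u v : bilin b -> tens_lift b (u ⊗ v) = b u v.
Proof.
move=> [br bl].
pose br' x : {linear V -> W} :=
  HB.pack (b x) (GRing.isLinear.Build k V W _ (b x) (br x)).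
pose bl' y : {linear U -> W} :=
  HB.pack (b^~ y) (GRing.isLinear.Build k U W _ (b^~ y) (bl y)).
rewrite {2}(coord_vbasis (memvf u)) -[RHS]/(bl' v _) linear_sum /tens_lift /=.
apply: eq_bigr => i _; rewrite -[RHS]/(bl' v _) linearZ /=.
rewrite {2}(coord_vbasis (memvf v)) -[b _ (\sum_(_ < _) _)]/(br' _ _).
rewrite linear_sum scaler_sumr /=.
by apply: eq_bigr => j _; rewrite -[b _ (_ *: _)]/(br' _ _) linearZ /= scalerA mxE.
Qed.

Lemma tens_lift_uniq b f : (forall u v, f (u ⊗ v) = b u v) -> f =1 tens_lift b.
Proof.
move=> fb t; rewrite /tens_lift {1}(matrix_sum_delta (t : 'M_(_, _))).
rewrite (linear_sum f) /=; apply: eq_bigr => i _.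
rewrite (linear_sum f) /=; apply: eq_bigr => j _.
rewrite (linearZ_LR f) -fb; congr (_ *: f _); apply/matrixP=> p q.
rewrite !mxE !coord_free ?(basis_free (vbasisP _)) //.
by rewrite -natrM mulnb (eq_sym p) (eq_sym q).
Qed.

End TensorTheory.

Definition tens_map (k : fieldType) (U V U' V' : vectType k)
    (f : U -> U') (g : V -> V') : tens U V -> tens U' V' :=
  tens_lift (fun u v => f u ⊗ g v).

Definition tens_assoc (k : fieldType) (U V W : vectType k) :
    tens (tens U V) W -> tens U (tens V W) :=
  tens_lift (fun t w => tens_lift (fun u v => u ⊗ (v ⊗ w)) t).

(* The product of the algebra A ⊗ B: (a ⊗ b) (a' ⊗ b') = a a' ⊗ b b'. *)
Definition tens_mul (k : fieldType) (A B : falgType k) (s t : tens A B) :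
    tens A B :=
  tens_lift (fun a b => tens_lift (fun a' b' => (a * a') ⊗ (b * b')) t) s.

HB.mixin Record isCoalgebra (k : fieldType) C of Vector k C := {
  comul : {linear C -> tens C C};
  counit : {linear C -> k^o};
  comulA : forall x,
    tens_assoc (tens_map comul idfun (comul x)) =
    tens_map idfun comul (comul x);
  counitl : forall x, tens_lift (fun a b => counit a *: b) (comul x) = x;
  counitr : forall x, tens_lift (fun a b => counit b *: a) (comul x) = x
}.

#[short(type="coalgType")]
HB.structure Definition Coalgebra (k : fieldType) :=
  { C of Vector k C & isCoalgebra k C }.

HB.mixin Record isBialgebra (k : fieldType) A
    of Falgebra k A & Coalgebra k A := {
  comulM : forall x y : A, comul (x * y) = tens_mul (comul x) (comul y);
  comul1 : comul (1 : A) = 1 ⊗ 1;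
  counitM : forall x y : A, counit (x * y) = counit x * counit y;
  counit1 : counit (1 : A) = 1
}.

(* No generality is lost with [falgType] requiring 1 != 0: the counit maps    *)
(* 1 to 1, so a bialgebra over a field is never zero.                         *)
#[short(type="bialgType")]
HB.structure Definition Bialgebra (k : fieldType) :=
  { A of Falgebra k A & Coalgebra k A & isBialgebra k A }.

Section StructureConstants.
Variables (k : fieldType) (V : vectType k) (I : finType).

Definition is_basis (c : I -> V) : bool := basis_of fullv (codom c).

(* The coefficient of c i in the expansion of x along the basis c. *)
Definition basis_coord (c : I -> V) (i : I) (x : V) : k :=
  coord (codom_tuple c) (enum_rank i) x.

(* The bilinear product with c i . c j = \sum_l S i j l *: c l. *)
Definition struct_mul (c : I -> V) (S : I -> I -> I -> k) (x y : V) : V :=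
  \sum_i \sum_j (basis_coord c i x * basis_coord c j y) *:
    \sum_l S i j l *: c l.

Lemma basis_coordE (c : I -> V) (i j : I) :
  is_basis c -> basis_coord c i (c j) = (i == j)%:R.
Proof.
move=> /basis_free fc; rewrite /basis_coord.
have -> : c j = (codom_tuple c)`_(enum_rank j) by rewrite nth_codom enum_rankK.
rewrite coord_free; first by rewrite (inj_eq enum_rank_inj) eq_sym.
exact: fc.
Qed.

Lemma struct_mulE (c : I -> V) (S : I -> I -> I -> k) (i j : I) :
  is_basis c -> struct_mul c S (c i) (c j) = \sum_l S i j l *: c l.
Proof.
move=> bc; rewrite /struct_mul (bigD1 i) //= (bigD1 j) //=.
rewrite !basis_coordE // !eqxx mulr1 scale1r.
rewrite [X in _ + X + _]big1 => [|j' /negPf nj]; last first.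
  by rewrite !basis_coordE // nj mulr0 scale0r.
rewrite [X in _ + X]big1 ?addr0 // => i' /negPf ni; apply: big1 => j' _.
by rewrite !basis_coordE // ni mul0r scale0r.
Qed.

Definition is_unital_assoc_alg (mul : V -> V -> V) (e : V) : Prop :=
  [/\ bilin mul, associative mul, left_id e mul & right_id e mul].

End StructureConstants.

Definition istruct (k : fieldType) (I : finType) (F : I -> I -> I -> k)
    (i j l : I) : k :=
  \sum_i' \sum_j' \sum_l' F i' l' j * F l' j' i * F j' i' l.

(* Main.v *)
(* Let <,> be the bilinear form making c orthonormal.  Since F = G, it is a    *)
(* Hopf pairing, <x y, z> = <x, z1> <y, z2>, and the new product is            *)
(* x o y = <x1, y2> x2 y1.   Expanding with the compatibility of product and   *)
(* coproduct, both (x o y) o z and x o (y o z) become                          *)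
(* <x1, y3> <x2, z2> <y1, z3> x3 y2 z1.  The unit laws follow from             *)
(* Delta 1 = 1 (x) 1 together with <1, z1> z2 = z = z1 <1, z2>.                *)

From HB Require Import structures.
Require Import Defs.
From mathcomp Require Import all_boot all_order all_algebra all_field.
From mathcomp Require Import ring.

Set Implicit Arguments.
Unset Strict Implicit.
Unset Printing Implicit Defensive.

Import GRing.Theory.
Local Open Scope ring_scope.

(** Since F = G, the single array [F] encodes both product and coproduct, so associativity, the unit
    laws, Δ(1) = 1 ⊗ 1 and multiplicativity of Δ all become identities between sums of entries of
    [F]; the theorem then follows from these identities.

    Associativity ([istruct_assoc]): in a composite of two diamond products, the intermediate index
    m is the upper index of one factor from each product. Multiplicativity of Δ ([sum_bialg_compat])
    trades the sum over m for four new indices, and associativity of [F] gathers the factors into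
    four triple-product constants [T]. These sit at the vertices of a tetrahedron whose six edges
    are the summed indices. The two bracketings give the same tetrahedron up to relabelling
    ([sum6_rotate]).

    Units ([istruct_unitl], [istruct_unitr]): Δ(1) = 1 ⊗ 1 splits a contraction with [lam] into two,
    and the unit laws of [F] turn each into a Kronecker delta. *)

Section BilinSum.
Variables (k : fieldType) (U V W : lmodType k) (b : U -> V -> W).
Hypothesis hb : bilin b.

Lemma bilin_suml (J : finType) (a : J -> k) (f : J -> U) y :
  b (\sum_i a i *: f i) y = \sum_i a i *: b (f i) y.
Proof.
pose g : {linear U -> W} :=
  HB.pack (b^~ y) (GRing.isLinear.Build k U W _ (b^~ y) (hb.2 y)).
rewrite -[LHS]/(g _) linear_sum; apply: eq_bigr => i _.
by rewrite linearZ.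
Qed.

Lemma bilin_sumr (J : finType) (a : J -> k) (f : J -> V) x :
  b x (\sum_i a i *: f i) = \sum_i a i *: b x (f i).
Proof.
pose g : {linear V -> W} :=
  HB.pack (b x) (GRing.isLinear.Build k V W _ (b x) (hb.1 x)).
rewrite -[LHS]/(g _) linear_sum; apply: eq_bigr => i _.
by rewrite linearZ.
Qed.

End BilinSum.

(** * Algebra axioms reduced to identities between structure constants *)

Section StructMul.
Variables (k : fieldType) (V : vectType k) (I : finType) (c : I -> V).
Hypothesis hc : is_basis c.

Lemma basis_coord_linear i : scalar (basis_coord c i).
Proof. by move=> a x y; rewrite /basis_coord linearP. Qed.

HB.instance Definition _ i :=
  GRing.isLinear.Build k V k^o _ (basis_coord c i : V -> k^o)
    (basis_coord_linear i).

Lemma basis_sum_coord x : x = \sum_i basis_coord c i x *: c i.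
Proof.
have /(coord_span (X := codom_tuple c)) {1}-> : x \in <<codom_tuple c>>%VS.
  by rewrite (span_basis hc) memvf.
rewrite (reindex_onto (@enum_rank I) (@enum_val I predT)) /=; last first.
  by move=> i _; rewrite enum_valK.
apply: eq_big => [i|i _]; first by rewrite enum_rankK eqxx.
by rewrite nth_codom enum_rankK.
Qed.

Lemma basis_coord_sum i (a : I -> k) : basis_coord c i (\sum_j a j *: c j) = a i.
Proof.
rewrite linear_sum (bigD1 i) //= linearZ /= basis_coordE // eqxx mulr1.
rewrite big1 ?addr0 // => j /negPf nj.
by rewrite linearZ /= basis_coordE // eq_sym nj mulr0.
Qed.

Variable S : I -> I -> I -> k.

Lemma struct_mul_bilin : bilin (struct_mul c S).
Proof.
split=> [u|v] a x y; rewrite /struct_mul scaler_sumr -big_split;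
  apply: eq_bigr => i _; rewrite scaler_sumr -big_split;
  apply: eq_bigr => j _; rewrite linearP /= scalerA -scalerDl; congr (_ *: _).
  by rewrite mulrDr mulrCA.
by rewrite mulrDl mulrA.
Qed.

Let struct_mul_suml := bilin_suml struct_mul_bilin.
Let struct_mul_sumr := bilin_sumr struct_mul_bilin.

Lemma struct_mul_assoc :
  (forall i j l p, \sum_m S i j m * S m l p = \sum_m S j l m * S i m p) ->
  associative (struct_mul c S).
Proof.
move=> SA x y z.
rewrite (basis_sum_coord x) !struct_mul_suml; apply: eq_bigr => i _.
congr (_ *: _); rewrite (basis_sum_coord y).
rewrite !(struct_mul_suml, struct_mul_sumr); apply: eq_bigr => j _.
congr (_ *: _); rewrite (basis_sum_coord z).
rewrite !(struct_mul_suml, struct_mul_sumr); apply: eq_bigr => l _.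
congr (_ *: _); rewrite !struct_mulE // struct_mul_suml struct_mul_sumr.
under eq_bigr do rewrite struct_mulE // scaler_sumr.
under [RHS]eq_bigr do rewrite struct_mulE // scaler_sumr.
rewrite exchange_big [RHS]exchange_big; apply: eq_bigr => p _ /=.
under eq_bigr do rewrite scalerA.
under [RHS]eq_bigr do rewrite scalerA.
by rewrite -!scaler_suml SA.
Qed.

Lemma struct_mul_unitl (lam : I -> k) :
  (forall j p, \sum_i lam i * S i j p = (j == p)%:R) ->
  left_id (\sum_i lam i *: c i) (struct_mul c S).
Proof.
move=> Sl x; rewrite (basis_sum_coord x) struct_mul_sumr.
apply: eq_bigr => j _; congr (_ *: _); rewrite struct_mul_suml.
under eq_bigr do rewrite struct_mulE // scaler_sumr.
rewrite exchange_big /= [RHS]basis_sum_coord; apply: eq_bigr => p _.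
rewrite basis_coordE // eq_sym -Sl scaler_suml.
by apply: eq_bigr => i _; rewrite scalerA.
Qed.

Lemma struct_mul_unitr (lam : I -> k) :
  (forall i p, \sum_j lam j * S i j p = (i == p)%:R) ->
  right_id (\sum_i lam i *: c i) (struct_mul c S).
Proof.
move=> Sl x; rewrite (basis_sum_coord x) struct_mul_suml.
apply: eq_bigr => i _; congr (_ *: _); rewrite struct_mul_sumr.
under eq_bigr do rewrite struct_mulE // scaler_sumr.
rewrite exchange_big /= [RHS]basis_sum_coord; apply: eq_bigr => p _.
rewrite basis_coordE // eq_sym -Sl scaler_suml.
by apply: eq_bigr => j _; rewrite scalerA.
Qed.

End StructMul.

(** * Coordinates and multiplication on the tensor product *)

Section TensorCoordinates.
Variables (k : fieldType) (U V : vectType k) (I : finType).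
Variables (c : I -> U) (d : I -> V).
Hypotheses (hc : is_basis c) (hd : is_basis d).

Definition tens_coord (p q : I) : tens U V -> k^o :=
  tens_lift (fun u v => basis_coord c p u * basis_coord d q v : k^o).

HB.instance Definition _ p q := GRing.Linear.on (tens_coord p q).

Lemma tens_coordE p q u v :
  tens_coord p q (u ⊗ v) = basis_coord c p u * basis_coord d q v.
Proof.
apply: (@tens_liftE _ _ _ k^o); split=> [x|y] a s t; rewrite linearP /=.
  by rewrite mulrDr mulrCA.
by rewrite mulrDl -mulrA.
Qed.

End TensorCoordinates.

Section TensMul.
Variables (k : fieldType) (A B : falgType k).

Lemma tens_mul_inner_bilin (a : A) (b : B) :
  bilin (fun a' b' => (a * a') ⊗ (b * b')).
Proof.
have [tr tl] := @tensor_bilin k A B.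
by split=> [u|v] r x y; rewrite mulrDr -scalerAr ?tr ?tl.
Qed.

Lemma tens_mulE (a a' : A) (b b' : B) :
  tens_mul (a ⊗ b) (a' ⊗ b') = (a * a') ⊗ (b * b').
Proof.
have [tr tl] := @tensor_bilin k A B.
rewrite /tens_mul tens_liftE.
  by rewrite tens_liftE //; exact: tens_mul_inner_bilin.
(* Remaining goal: bilinearity of the outer map, checked termwise on the double sum defining
   [tens_lift]. *)
split=> [u|v] r x y; rewrite /tens_lift scaler_sumr -big_split;
  apply: eq_bigr => i _; rewrite scaler_sumr -big_split;
  apply: eq_bigr => j _; rewrite mulrDl -scalerAl ?tr ?tl /= scalerDr !scalerA;
  by rewrite [r * _]mulrC.
Qed.

Lemma tens_mul_bilin : bilin (@tens_mul k A B).
Proof.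
split=> [s|t] r x y; last by rewrite /tens_mul linearP.
rewrite /tens_mul {1 3 5}/tens_lift scaler_sumr -big_split.
apply: eq_bigr => i _; rewrite scaler_sumr -big_split.
by apply: eq_bigr => j _; rewrite linearP /= scalerDr !scalerA [r * _]mulrC.
Qed.

End TensMul.

(** * Associativity of the diamond product *)

Lemma sum_mul_contract (k : fieldType) (I : finType) (X Y : I -> I -> k)
    (v w : I -> k) :
  \sum_b \sum_a (\sum_e X a e * Y e b) * (w b * v a) =
  \sum_e (\sum_a X a e * v a) * (\sum_b Y e b * w b).
Proof.
under [RHS]eq_bigr do rewrite big_distrlr exchange_big.
rewrite [RHS]exchange_big; apply: eq_bigr => b _ /=.
rewrite [RHS]exchange_big; apply: eq_bigr => a _ /=.
by rewrite mulr_suml; apply: eq_bigr => e _; ring.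
Qed.

Section DiamondAssoc.
Variables (k : fieldType) (I : finType) (F : I -> I -> I -> k).

Hypothesis FA : forall i j l p,
  \sum_m F i j m * F m l p = \sum_m F j l m * F i m p.
Hypothesis FB : forall i j p q,
  \sum_m F i j m * F p q m =
  \sum_g \sum_h \sum_s \sum_t F g h i * F s t j * F g s p * F h t q.

(* Structure constants of both the triple product and the iterated coproduct. *)
Let T i j l p := \sum_m F i j m * F m l p.

(** This is [FB] extended bilinearly to arbitrary weights [X] and [Y]; it eliminates the
    intermediate index of a composite of two diamond products. *)
Lemma sum_bialg_compat (X Y : I -> I -> k) :
  \sum_m (\sum_b \sum_a X b a * F b a m) * (\sum_f \sum_e Y f e * F f e m) =
  \sum_g \sum_h \sum_s \sum_t
    (\sum_b \sum_a X b a * (F g h b * F s t a)) *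
    (\sum_f \sum_e Y f e * (F g s f * F h t e)).
Proof.
(* Indices are grouped in pairs to keep the interchanges of sums short. *)
pose J := (I * I)%type.
have compat (u v : J) : \sum_m F u.1 u.2 m * F v.1 v.2 m =
    \sum_(y : J) \sum_(z : J)
      (F y.1 y.2 u.1 * F z.1 z.2 u.2) * (F y.1 z.1 v.1 * F y.2 z.2 v.2).
  rewrite FB pair_bigA; apply: eq_bigr => y _; rewrite pair_bigA.
  by apply: eq_bigr => z _; rewrite !mulrA.
transitivity (\sum_(u : J) \sum_(v : J)
    X u.1 u.2 * Y v.1 v.2 * \sum_m F u.1 u.2 m * F v.1 v.2 m).
  under eq_bigr do rewrite !pair_bigA big_distrlr.
  rewrite exchange_big; apply: eq_bigr => u _ /=.
  rewrite exchange_big; apply: eq_bigr => v _ /=.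
  by rewrite mulr_sumr; apply: eq_bigr => m _; ring.
rewrite [RHS]pair_bigA /=.
under [RHS]eq_bigr => y _.
  rewrite pair_bigA /=.
  under eq_bigr do rewrite !pair_bigA big_distrlr.
  rewrite exchange_big.
  under eq_bigr do rewrite exchange_big.
  over.
rewrite [RHS]exchange_big; apply: eq_bigr => u _ /=.
rewrite [RHS]exchange_big; apply: eq_bigr => v _ /=.
rewrite compat mulr_sumr; apply: eq_bigr => y _.
by rewrite mulr_sumr; apply: eq_bigr => z _; ring.
Qed.

(** Each of the six indices is shared by exactly two of the four tensors, and each two tensors share
    exactly one index; both sides are this tetrahedral contraction with the edges named
    differently. *)
Lemma sum6_rotate (A B C D : I -> I -> I -> k) :
  \sum_g \sum_h \sum_s \sum_t
    (\sum_c A s t c * B c g h) * (\sum_d C h t d * D d g s) =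
  \sum_g \sum_h \sum_s \sum_t
    (\sum_c D s t c * A c g h) * (\sum_d B h t d * C d g s).
Proof.
have sum6 (f : I -> I -> I -> I -> I -> I -> k) :
    \sum_g \sum_h \sum_s \sum_t \sum_c \sum_d f g h s t c d =
    \sum_(x : I * I * I * I * I * I)
      f x.1.1.1.1.1 x.1.1.1.1.2 x.1.1.1.2 x.1.1.2 x.1.2 x.2.
  by rewrite !pair_bigA.
have distr6 (A' B' C' D' : I -> I -> I -> k) :
    \sum_g \sum_h \sum_s \sum_t
      (\sum_c A' s t c * B' c g h) * (\sum_d C' h t d * D' d g s) =
    \sum_g \sum_h \sum_s \sum_t \sum_c \sum_d
      (A' s t c * B' c g h) * (C' h t d * D' d g s).
  by do 4![apply: eq_bigr => ? _]; rewrite big_distrlr.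
rewrite !distr6 !sum6.
(* The relabelling is forced by matching the arguments of each tensor on the two sides. *)
pose r (x : I * I * I * I * I * I) :=
  let: (g, h, s, t, c, d) := x in (t, c, d, g, s, h).
rewrite [RHS](reindex_inj (h := r)) /=; last first.
  by move=> [[[[[? ?] ?] ?] ?] ?] [[[[[? ?] ?] ?] ?] ?] [-> -> -> -> -> ->].
by apply: eq_bigr => -[[[[[g h] s] t] c] d] _ /=; ring.
Qed.

Lemma istruct_assoc i j l p :
  \sum_m istruct F i j m * istruct F m l p =
  \sum_m istruct F j l m * istruct F i m p.
Proof.
(* The defining triple sum is cyclic in its three factors; the next three forms isolate the factor
   whose upper index is [m], as [sum_bialg_compat] requires. *)
have outE u v m :
    istruct F u v m = \sum_b \sum_a (\sum_e F a e v * F e b u) * F b a m.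
  rewrite /istruct exchange_big; apply: eq_bigr => b _ /=.
  by apply: eq_bigr => a _; rewrite mulr_suml.
have inlE m : istruct F m l p =
    \sum_f \sum_e (\sum_d F e d p * F d f l) * F f e m.
  rewrite /istruct exchange_big /= [RHS]exchange_big; apply: eq_bigr => e _ /=.
  rewrite exchange_big; apply: eq_bigr => f _ /=.
  by rewrite mulr_suml; apply: eq_bigr => d _; ring.
have inrE m : istruct F i m p =
    \sum_d \sum_f (\sum_e F f e i * F e d p) * F d f m.
  rewrite /istruct; apply: eq_bigr => d _ /=.
  rewrite exchange_big; apply: eq_bigr => f _ /=.
  by rewrite mulr_suml; apply: eq_bigr => e _; ring.
have TE u v w z : \sum_a F a w z * F u v a = T u v w z.
  by apply: eq_bigr => a _; rewrite mulrC.
have TE' u v w z : \sum_b F u b z * F v w b = T u v w z.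
  by rewrite /T FA; apply: eq_bigr => b _; rewrite mulrC.
have contract u v g h s t :
    \sum_b \sum_a (\sum_e F a e u * F e b v) * (F g h b * F s t a) =
    \sum_e T s t e u * T e g h v.
  by rewrite sum_mul_contract; apply: eq_bigr => e _; rewrite TE TE'.
under eq_bigr do rewrite outE inlE.
under [RHS]eq_bigr do rewrite outE inrE.
rewrite !sum_bialg_compat.
(* In Sweedler terms, [c], [g], [s] are the pairings <x1, y3>, <x2, z2>, <y1, z3>, while [h], [t],
   [d] are the factors of x3 y2 z1. *)
transitivity (\sum_g \sum_h \sum_s \sum_t
    (\sum_c T s t c j * T c g h i) * (\sum_d T h t d p * T d g s l)).
  by do 4![apply: eq_bigr => ? _]; rewrite !contract.
rewrite sum6_rotate.
by do 4![apply: eq_bigr => ? _]; rewrite !contract.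
Qed.

End DiamondAssoc.

(** * Unit laws of the diamond product *)

Section DiamondUnit.
Variables (k : fieldType) (I : finType) (F : I -> I -> I -> k) (lam : I -> k).
Hypotheses (F1l : forall j p, \sum_i lam i * F i j p = (j == p)%:R)
           (F1r : forall i p, \sum_j lam j * F i j p = (i == p)%:R)
           (FD1 : forall p q, \sum_i lam i * F p q i = lam p * lam q).

Lemma sum_pred1 (j : I) (f : I -> k) : \sum_i (i == j)%:R * f i = f j.
Proof.
rewrite (bigD1 j) //= eqxx mul1r big1 ?addr0 // => i /negPf->.
exact: mul0r.
Qed.

Lemma istruct_unitl j p : \sum_i lam i * istruct F i j p = (j == p)%:R.
Proof.
(* [FD1] splits the sum over [i] into [lam e * lam b]; the [b] part has become the delta by [F1l],
   and the [e] part awaits [F1r]. *)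
transitivity (\sum_a (a == p)%:R * \sum_e lam e * F a e j); last first.
  by rewrite sum_pred1 F1r eq_sym.
under eq_bigr do rewrite mulr_sumr.
rewrite exchange_big; apply: eq_bigr => a _ /=.
rewrite -F1l big_distrlr exchange_big /=.
under eq_bigr do rewrite mulr_sumr.
rewrite exchange_big [RHS]exchange_big; apply: eq_bigr => b _ /=.
under eq_bigr do rewrite mulr_sumr.
rewrite exchange_big; apply: eq_bigr => e _ /=.
transitivity (F a e j * F b a p * \sum_i lam i * F e b i).
  by rewrite mulr_sumr; apply: eq_bigr => i _; ring.
by rewrite FD1; ring.
Qed.

Lemma istruct_unitr i p : \sum_j lam j * istruct F i j p = (i == p)%:R.
Proof.
(* Here [FD1] yields [lam a * lam e]; [F1l] handles [e] and [F1r] handles [a]. *)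
transitivity (\sum_b (b == i)%:R * \sum_a lam a * F b a p); last first.
  by rewrite sum_pred1 F1r.
under eq_bigr do rewrite /istruct exchange_big mulr_sumr.
rewrite exchange_big; apply: eq_bigr => b _ /=.
rewrite -F1l big_distrlr [RHS]exchange_big /=.
under eq_bigr do rewrite mulr_sumr.
rewrite exchange_big; apply: eq_bigr => a _ /=.
under eq_bigr do rewrite mulr_sumr.
rewrite exchange_big; apply: eq_bigr => e _ /=.
transitivity (F e b i * F b a p * \sum_j lam j * F a e j).
  by rewrite mulr_sumr; apply: eq_bigr => j _; ring.
by rewrite FD1; ring.
Qed.

End DiamondUnit.

(** * Bialgebra axioms read off in the basis *)

Theorem theorem3p1 (k : fieldType) (A : bialgType k) (I : finType) (c : I -> A)
    (F G : I -> I -> I -> k) (lam : I -> k)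
    (hc : is_basis c)
    (hF : forall i j, c i * c j = \sum_l F i j l *: c l)
    (hlam : in_alg A 1 = \sum_i lam i *: c i)
    (hG : forall l, comul (c l) = \sum_i \sum_j G i j l *: (c i ⊗ c j))
    (hFG : forall i j l, F i j l = G i j l) :
  is_unital_assoc_alg (struct_mul c (istruct F)) (\sum_i lam i *: c i).
Proof.
have e1 : 1 = \sum_i lam i *: c i by rewrite -hlam /= scale1r.
have cA (f : I -> k) p : basis_coord c p (\sum_i f i *: c i) = f p.
  exact: basis_coord_sum.
have cM i j p : basis_coord c p (c i * c j) = F i j p by rewrite hF cA.
have cD l p q : tens_coord c c p q (comul (c l)) = F p q l.
  rewrite hG linear_sum -(sum_pred1 p (fun i => F i q l)).
  apply: eq_bigr => i _; rewrite linear_sum -(sum_pred1 q (fun j => F i j l)).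
  rewrite mulr_sumr; apply: eq_bigr => j _.
  rewrite linearZ /= tens_coordE !basis_coordE // -hFG (eq_sym p) (eq_sym q).
  (* Scaling in [k^o] is exposed as multiplication so that [ring] applies. *)
  by rewrite -[LHS]/(_ * (_ * _)); ring.
have F1l j p : \sum_i lam i * F i j p = (j == p)%:R.
  rewrite eq_sym -(basis_coordE p j hc) -[c j in RHS]mul1r e1 mulr_suml.
  rewrite linear_sum; apply: eq_bigr => i _.
  by rewrite -scalerAl linearZ /= cM.
have F1r i p : \sum_j lam j * F i j p = (i == p)%:R.
  rewrite eq_sym -(basis_coordE p i hc) -[c i in RHS]mulr1 e1 mulr_sumr.
  rewrite linear_sum; apply: eq_bigr => j _.
  by rewrite -scalerAr linearZ /= cM.
(* The (p, q) coordinate of Δ(1) = 1 ⊗ 1. *)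
have FD1 p q : \sum_i lam i * F p q i = lam p * lam q.
  have := congr1 (tens_coord c c p q) (comul1 : comul (1 : A) = _).
  rewrite tens_coordE {1}e1 e1 !cA => <-; rewrite !linear_sum.
  by apply: eq_bigr => i _; rewrite !linearZ /= cD.
have FA i j l p : \sum_m F i j m * F m l p = \sum_m F j l m * F i m p.
  have := congr1 (basis_coord c p) (mulrA (c i) (c j) (c l)).
  rewrite !hF mulr_sumr mulr_suml !linear_sum => /esym e.
  transitivity (\sum_m basis_coord c p (F i j m *: c m * c l)).
    by apply: eq_bigr => m _; rewrite -scalerAl linearZ /= cM.
  by rewrite e; apply: eq_bigr => m _; rewrite -scalerAr linearZ /= cM.
(* The (p, q) coordinate of Δ(c_i c_j) = Δ(c_i) Δ(c_j). *)
have FB i j p q : \sum_m F i j m * F p q m =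
    \sum_g \sum_h \sum_s \sum_t F g h i * F s t j * F g s p * F h t q.
  have comulE l :
      comul (c l) = \sum_(y : I * I) F y.1 y.2 l *: (c y.1 ⊗ c y.2).
    by rewrite hG pair_bigA; apply: eq_bigr => y _; rewrite hFG.
  have := congr1 (tens_coord c c p q) (comulM (c i) (c j)).
  rewrite !comulE (bilin_suml (@tens_mul_bilin k A A)) hF.
  rewrite [comul _]linear_sum !(linear_sum (tens_coord c c p q)).
  under eq_bigr do rewrite !linearZ /= cD.
  move=> /= ->; rewrite [RHS]pair_bigA; apply: eq_bigr => y _.
  rewrite linearZ /= (bilin_sumr (@tens_mul_bilin k A A))
    (linear_sum (tens_coord c c p q)) scaler_sumr.
  rewrite [RHS]pair_bigA; apply: eq_bigr => z _.
  by rewrite linearZ /= tens_mulE tens_coordE !cM -[LHS]/(_ * (_ * _)) !mulrA.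
split.
- exact: struct_mul_bilin.
- apply: struct_mul_assoc => //; exact: istruct_assoc.
- by apply: struct_mul_unitl => //; apply: istruct_unitl.
- by apply: struct_mul_unitr => //; apply: istruct_unitr.
Qed.
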